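(* Let $d,\ell\geq 1$ be integers and let $v_1,\dots,v_\ell\in\mathbb{Z}^d$. There exists a constant $C_{\ell,d}=C_{\ell,d}(v_1,\dots,v_\ell)$ such that for every positive integer $N$ and every set $A\subseteq[1,N]^d$ with \[\frac{|A|}{N^d}\geq C_{\ell,d}\,N^{-1/\ell},\] there exists an integer $r>0$ such that \[\{rv_1,\dots,rv_\ell\}\subseteq A-A.\]
   Context: $[1,N]=\{1,2,\dots,N\}$ and $[1,N]^d$ is its $d$-fold Cartesian product. $A-A=\{a-a' : a,a'\in A\}$ denotes the difference set of $A$. *)

(* Defs.v *)
From HB Require Import structures.
From mathcomp Require Import all_boot all_order all_algebra.
From mathcomp Require Import finmap.

Set Implicit Arguments.
Unset Strict Implicit.
Unset Printing Implicit Defensive.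

Import Order.TTheory GRing.Theory Num.Theory.
Local Open Scope ring_scope.
Local Open Scope fset_scope.

(* [1, N]^d inside Z^d, whose points are integer row vectors. *)
Definition box (d N : nat) : {pred 'rV[int]_d} :=
  [pred x : 'rV[int]_d | [forall j, 1 <= x 0 j <= N%:Z]].
Arguments box : clear implicits.

Definition diffset (d : nat) (A : {fset 'rV[int]_d}) : {fset 'rV[int]_d} :=
  [fset a - a' | a in A, a' in A].

(* Main.v *)
Require Import Defs.
From HB Require Import structures.
From mathcomp Require Import all_boot all_order all_algebra.
From mathcomp Require Import finmap zify.
From mathcomp Require Import reals exp.

(** Pigeonhole in dimension [d l]: the translates of [A^l] by [r (v_1, .., v_l)],
    [0 <= r < N], all lie in a box of side [O(N)], and their total size
    [N |A|^l] exceeds the volume of that box. Hence two of them, for [r' < r],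
    meet, and [r - r'] is the required dilation. *)

Set Implicit Arguments.
Unset Strict Implicit.
Unset Printing Implicit Defensive.

Import Order.TTheory GRing.Theory Num.Theory.
Local Open Scope ring_scope.
Local Open Scope fset_scope.

(** The bounds exclude the two sources of collision: [absz] forgets the sign, and [inord] returns
    the default [0] above [K]. *)
Lemma inord_absz_inj (K : nat) (x y : int) :
  0 <= x <= K%:Z -> 0 <= y <= K%:Z ->
  inord `|x|%N = inord `|y|%N :> 'I_K.+1 -> x = y.
Proof.
move=> hx hy /(congr1 val) /=; rewrite !inordK; lia.
Qed.

(** Since [r * w] lies between [- N * V] and [N * V], the shift by [N * V] makes the coordinate
    nonnegative and at most [N + 2 * N * V]. *)
Lemma translate_coord_bound (N V r : nat) (a w : int) :
  (r < N)%N -> (`|w| <= V)%N -> 1 <= a <= N%:Z ->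
  (0 <= a + r%:Z * w + (N * V)%N%:Z <= ((2 * V + 1) * N)%N%:Z)%R.
Proof.
move=> hr hw ha; have : `|r%:Z * w| <= (N * V)%N%:Z.
  by rewrite normrM -!abszE -PoszM lez_nat leq_mul // ltnW.
lia.
Qed.

Lemma dilate_subset_diffset (d l N V : nat) (v : 'I_l -> 'rV[int]_d)
    (A : {fset 'rV[int]_d}) :
  (forall i j, (`|v i 0%R j| <= V)%N) ->
  {subset A <= box d N} ->
  ((((2 * V + 1) * N).+1 ^ d) ^ l < N * #|` A| ^ l)%N ->
  exists r : int, 0 < r /\ [fset r *: v i | i in 'I_l] `<=` diffset A.
Proof.
set K := ((2 * V + 1) * N)%N => hv hA hcard.
(* [f] sends a dilation [r] and a tuple [(a_i)] to the tuple [(a_i + r v_i)], shifted so that every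
   coordinate lies in [[0, K]]; a collision of [f] is a common point of two translates. *)
pose f (p : 'I_N * {ffun 'I_l -> A}) : {ffun 'I_l -> {ffun 'I_d -> 'I_K.+1}} :=
  [ffun i => [ffun j =>
    inord (absz (val (p.2 i) 0 j + (p.1 : nat)%:Z * v i 0 j + (N * V)%N%:Z)%R)]].
have hbd (p : 'I_N * {ffun 'I_l -> A}) i j :
    (0 <= val (p.2 i) 0 j + (p.1 : nat)%:Z * v i 0 j + (N * V)%N%:Z <= K%:Z)%R.
  apply: translate_coord_bound => //.
  by have := hA _ (valP (p.2 i)); rewrite inE => /forallP /(_ j).
have /injectivePn [p [q neq_pq eq_f]] : ~~ injectiveb f.
  apply: contraL hcard => /injectiveP /leq_card.
  by rewrite card_prod !card_ffun !card_ord -cardfE -leqNgt.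
have eq_tr i : (val (p.2 i) + (p.1 : nat)%:Z *: v i =
                val (q.2 i) + (q.1 : nat)%:Z *: v i)%R.
  apply/rowP => j; rewrite !mxE.
  move/ffunP/(_ i): eq_f; rewrite !ffunE => /ffunP/(_ j); rewrite !ffunE.
  by move/(inord_absz_inj (hbd p i j) (hbd q i j))/addIr.
(* With equal dilations, cancelling [r v_i] would make the two tuples equal as well. *)
have {neq_pq} neq1 : (p.1 : nat) != q.1.
  apply: contra neq_pq => /eqP eq1; apply/eqP.
  rewrite [p]surjective_pairing [q]surjective_pairing; congr pair.
    exact: val_inj.
  by apply/ffunP => i; apply/val_inj/(addIr ((p.1 : nat)%:Z *: v i)); rewrite eq_tr eq1.
wlog lt_pq : p q eq_tr neq1 {eq_f} / (p.1 < q.1)%N.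
  move=> hwlog; case: (ltngtP p.1 q.1) => [/hwlog||eq1]; first exact.
    by move=> /hwlog; apply=> //; rewrite eq_sym.
  by rewrite eq1 eqxx in neq1.
(* Rearranging [eq_tr] gives [(q.1 - p.1) v_i = p.2 i - q.2 i], with the same dilation for all
   [i]. *)
exists ((q.1 : nat)%:Z - (p.1 : nat)%:Z); split; first by rewrite subr_gt0 ltz_nat.
apply/fsubsetP => _ /imfsetP [i _ ->].
apply/imfset2P; exists (val (p.2 i)); first exact: valP.
exists (val (q.2 i)); first exact: valP.
by apply/eqP; rewrite scalerBl subr_eq addrAC eq_tr [X in _ == X]addrC addKr.
Qed.

(** Clearing [N ^ d] and taking [l]-th powers turns the factor [N ^ (-1/l)] into [1 / N], which
    leaves an inequality between natural numbers. *)
Lemma card_ge_of_density_ge (R : realType) (d l N m c : nat) :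
  (0 < l)%N -> (0 < N)%N ->
  (c ^ d)%:R * N%:R `^ (- l%:R^-1) <= m%:R / N%:R ^+ d :> R ->
  (((c * N) ^ d) ^ l <= N * m ^ l)%N.
Proof.
move=> l_gt0 N_gt0.
have N0 : 0 < N%:R :> R by rewrite ltr0n.
rewrite ler_pdivlMr ?exprn_gt0 // => hm.
have : ((c ^ d)%:R * N%:R `^ (- l%:R^-1) * N%:R ^+ d) ^+ l <= m%:R ^+ l :> R.
  apply: lerXn2r hm; rewrite nnegrE ?ler0n //.
  by rewrite !mulr_ge0 ?powR_ge0 ?exprn_ge0 ?ler0n.
have -> : ((c ^ d)%:R * N%:R `^ (- l%:R^-1) * N%:R ^+ d) ^+ l =
          (((c * N) ^ d) ^ l)%:R / N%:R :> R.
  have -> : N%:R^-1 = (N%:R `^ (- l%:R^-1)) ^+ l :> R.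
    by rewrite -powR_mulrn ?powR_ge0 // -powRrM mulNr mulVf ?pnatr_eq0 -?lt0n //
       powR_inv1 // ltW.
  by rewrite !natrX natrM !exprMn mulrAC.
by rewrite ler_pdivrMr // -natrX -natrM ler_nat [(N * _)%N]mulnC.
Qed.

Theorem theorem1p1 (R : realType) (d l : nat) (hd : (1 <= d)%N) (hl : (1 <= l)%N)
    (v : 'I_l -> 'rV[int]_d) :
  exists C : R, forall (N : nat) (A : {fset 'rV[int]_d}),
    (0 < N)%N ->
    {subset A <= box d N} ->
    C * N%:R `^ (- l%:R^-1) <= #|` A|%:R / N%:R ^+ d ->
    exists r : int, 0 < r /\ [fset r *: v i | i in 'I_l] `<=` diffset A.
Proof.
pose V := \max_(i < l) \max_(j < d) `|v i 0%R j|%N.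
have hV i j : (`|v i 0%R j| <= V)%N.
  apply: leq_trans (leq_bigmax i).
  exact: (leq_bigmax (F := fun j => `|v i 0%R j|%N) j).
(* The pigeonhole needs a strict inequality: [(2 * V + 1) * N + 1 < (2 * V + 3) * N] for [N >= 1],
   and strictness survives the powers because [d] and [l] are positive. *)
exists (((2 * V + 3) ^ d)%:R) => N A N_gt0 hA /(card_ge_of_density_ge hl N_gt0) hcard.
apply: (dilate_subset_diffset hV hA); apply: leq_trans hcard.
rewrite !ltn_exp2r //; nia.
Qed.
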